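(* Let $X$ be a primary Hopf manifold of dimension $n\ge 2$, and for each $\delta\in\mathbb{C}^*$ let $L_\delta$ denote the flat holomorphic line bundle on $X$ associated with the representation of $\pi_1(X)\cong\mathbb{Z}$ mapping $1\mapsto\delta$. Then for any $\delta_1,\delta_2\in\mathbb{C}^*$ the Bott–Chern first Chern classes satisfy $$\log|\delta_2|\,c_1(L_{\delta_1})=\log|\delta_1|\,c_1(L_{\delta_2})\quad\text{in } H^{1,1}_{\mathrm{BC}}(X,\mathbb{R}).$$ In particular, $c_1(L_\delta)$ depends solely on the modulus $|\delta|$.
   Context: A primary Hopf manifold of dimension $n\ge2$ is a compact complex manifold $X=(\mathbb{C}^n\setminus\{0\})/\langle\gamma\rangle$, where $\gamma$ is (the restriction of) a biholomorphic contraction fixing the origin; then $\pi_1(X)\cong\mathbb{Z}$ is generated by $\gamma$. The bundle $L_\delta$ is $((\mathbb{C}^n\setminus\{0\})\times\mathbb{C})/\big((z,v)\sim(\gamma(z),\delta v)\big)$. For a compact complex manifold $X$, the real Bott–Chern cohomology group is $$H^{1,1}_{\mathrm{BC}}(X,\mathbb{R})=\frac{\{\alpha\in A^{1,1}(X,\mathbb{R})\mid d\alpha=0\}}{\sqrt{-1}\,\partial\bar\partial\, C^\infty(X,\mathbb{R})},$$ where $A^{1,1}(X,\mathbb{R})$ is the space of smooth real $(1,1)$-forms. For a holomorphic line bundle $L$, its Bott–Chern first Chern class $c_1(L)\in H^{1,1}_{\mathrm{BC}}(X,\mathbb{R})$ is the class of $\frac{\sqrt{-1}}{2\pi}\Theta(L,h)=-\frac{\sqrt{-1}}{2\pi}\partial\bar\partial\log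 h$ for any smooth Hermitian metric $h$ on $L$. *)

(* Defs.v *)
From HB Require Import structures.
From mathcomp Require Import all_boot all_order all_algebra.
From mathcomp Require Import generic_quotient complex.
From mathcomp Require Import all_classical all_reals all_analysis.

Set Implicit Arguments.
Unset Strict Implicit.
Unset Printing Implicit Defensive.

Import Order.TTheory GRing.Theory Num.Theory.
Import numFieldNormedType.Exports.

Local Open Scope classical_set_scope.
Local Open Scope ring_scope.
Local Open Scope complex_scope.
Local Open Scope quotient_scope.

(* Complex numbers, as a bare numFieldType: this gives them the topology and the
   normed module structure that every numFieldType carries over itself; [differentiable] on [CC]-modules is then
   complex differentiability. *)
Definition CC (R : realType) : numFieldType := R[i].
Notation "''CV[' R ]_ n" := 'rV[CC R]_n
  (at level 8, n at level 2).

Definition RtoC (R : realType) (x : R) : CC R := x%:C.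
Definition Ci (R : realType) : CC R := 'i.
Definition Cconj (R : realType) (x : CC R) : CC R := conjc x.
Definition Cabs (R : realType) (x : CC R) : R := Normc.normc x.

Section Calculus.
Variables (R : realType) (n : nat).
Implicit Types (U : set 'CV[R]_n) (f : 'CV[R]_n -> CC R) (z v : 'CV[R]_n).

Definition holomorphic_on m U (g : 'CV[R]_n -> 'CV[R]_m) :=
  forall z, U z -> differentiable g z.

(* Derivative of f at z in the direction v for a real parameter. *)
Definition rderiv v f z : CC R :=
  derive1 (fun t : R => complex.Re (f (z + RtoC t *: v))) 0
  +i* derive1 (fun t : R => complex.Im (f (z + RtoC t *: v))) 0.

Definition rderivable v f z :=
  derivable (fun t : R => complex.Re (f (z + RtoC t *: v))) 0 1 /\
  derivable (fun t : R => complex.Im (f (z + RtoC t *: v))) 0 1.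

(* C^oo in the real sense: real directional derivatives of every order exist
   and are continuous. *)
Definition smooth_on U f :=
  forall s : seq 'CV[R]_n, let g := foldr rderiv f s in
  forall z, U z -> {for z, continuous g} /\ forall v, rderivable v g z.

Definition basis_vec (j : 'I_n) : 'CV[R]_n := delta_mx 0 j.

Definition wirt (j : 'I_n) f z : CC R :=
  (rderiv (basis_vec j) f z - Ci R * rderiv (Ci R *: basis_vec j) f z) / 2.

Definition wirtbar (j : 'I_n) f z : CC R :=
  (rderiv (basis_vec j) f z + Ci R * rderiv (Ci R *: basis_vec j) f z) / 2.

(* The matrix a stands for the (1,1)-form \sum_(j, k) a j k dz_j /\ dzbar_k. *)
Definition ddbar f z : 'M[CC R]_n :=
  \matrix_(j, k) wirt j (wirtbar k f) z.

Definition adjoint (a : 'M[CC R]_n) : 'M[CC R]_n := (map_mx (@Cconj R) a)^T.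

(* Pullback of a (1,1)-form by tau; [jacobian] acts on row vectors from the
   right, so its (j, l) entry is d tau_l / d z_j. *)
Definition pullback11 (tau : 'CV[R]_n -> 'CV[R]_n) (a : 'CV[R]_n -> 'M[CC R]_n)
    z : 'M[CC R]_n :=
  jacobian tau z *m a (tau z) *m adjoint (jacobian tau z).

(* The coefficients of dz_l /\ dz_j /\ dzbar_k and of dzbar_l /\ dz_j /\ dzbar_k
   in the exterior derivative vanish. *)
Definition d_closed_on U (a : 'CV[R]_n -> 'M[CC R]_n) :=
  forall z, U z -> forall l j k : 'I_n,
    wirt l (fun w => a w j k) z = wirt j (fun w => a w l k) z /\
    wirtbar l (fun w => a w j k) z = wirtbar k (fun w => a w j l) z.

Lemma rderivZ v (r : R) f :
  rderiv v (fun z => RtoC r * f z) = (fun z => RtoC r * rderiv v f z).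
Proof.
have dZ (g : R -> R) (x : R) : derive1 (fun t => r * g t) x = r * derive1 g x.
  have [->|r0] := eqVneq r 0.
    rewrite mul0r (_ : (fun _ => _) = cst 0) ?derive1_cst//.
    by apply/funext => t /=; rewrite mul0r.
  have [gx|ngx] := pselect (derivable g x 1).
    by rewrite !derive1E (deriveZ r gx).
  have nrgx : ~ derivable (fun t => r * g t) x 1.
    move=> rg; apply: ngx; have := @derivableZ _ _ _ _ r^-1 _ _ rg.
    rewrite (_ : r^-1 \*: _ = g)//; apply/funext => t /=.
    by rewrite /GRing.scale /= mulKf.
  have D0 (h : R -> R) : ~ derivable h x 1 -> derive1 h x = 0.
    by move=> nh; rewrite derive1E; exact: (dvgP nh).
  by rewrite (D0 _ ngx) (D0 _ nrgx) mulr0.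
apply/funext => z; rewrite /rderiv.
rewrite (_ : (fun t : R => complex.Re (RtoC r * _)) =
             fun t : R => r * complex.Re (f (z + RtoC t *: v))); last first.
  by apply/funext => t; case: (f _) => a b /=; rewrite mul0r subr0.
rewrite (_ : (fun t : R => complex.Im (RtoC r * _)) =
             fun t : R => r * complex.Im (f (z + RtoC t *: v))); last first.
  by apply/funext => t; case: (f _) => a b /=; rewrite mul0r addr0.
by rewrite !dZ; apply/eqP; rewrite eq_complex /= !mul0r subr0 addr0 !eqxx.
Qed.

Lemma wirtZ j (r : R) f z :
  wirt j (fun w => RtoC r * f w) z = RtoC r * wirt j f z.
Proof. by rewrite /wirt !rderivZ mulrCA -mulrBr mulrA. Qed.

Lemma wirtbarZ j (r : R) f z :
  wirtbar j (fun w => RtoC r * f w) z = RtoC r * wirtbar j f z.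
Proof. by rewrite /wirtbar !rderivZ mulrCA -mulrDr mulrA. Qed.

Lemma rderivableZ v (r : R) f z :
  rderivable v f z -> rderivable v (fun z => RtoC r * f z) z.
Proof.
move=> [fr fi]; split.
- rewrite (_ : (fun _ => _) =
    r \*: (fun t : R => complex.Re (f (z + RtoC t *: v)))); last first.
    by apply/funext => t /=; case: (f _) => a b /=; rewrite mul0r subr0.
  exact: derivableZ.
- rewrite (_ : (fun _ => _) =
    r \*: (fun t : R => complex.Im (f (z + RtoC t *: v)))); last first.
    by apply/funext => t /=; case: (f _) => a b /=; rewrite mul0r addr0.
  exact: derivableZ.
Qed.

Lemma smooth_onZ U (r : R) f :
  smooth_on U f -> smooth_on U (fun z => RtoC r * f z).
Proof.
move=> sf s; cbv zeta.
have -> : foldr rderiv (fun z => RtoC r * f z) s =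
          fun z => RtoC r * foldr rderiv f s z.
  by elim: s => //= v s ->; rewrite rderivZ.
move=> z /(sf s)[cf df]; split=> [|v]; last exact: rderivableZ.
exact: (@cvgM (CC R) _ (nbhs z) _ (fun=> RtoC r) _ (RtoC r) _ (cvg_cst _) cf).
Qed.

Lemma rderiv0 v : rderiv v (fun=> 0) = (fun=> 0).
Proof.
by apply/funext => z; rewrite /rderiv; congr (_ +i* _); exact: derive1_cst.
Qed.

Lemma smooth_on0 U : smooth_on U (fun=> 0).
Proof.
move=> s; cbv zeta.
have -> : foldr rderiv (fun=> 0) s = (fun=> 0).
  by elim: s => //= v s ->; rewrite rderiv0.
by move=> z _; split=> [|v]; [exact: cst_continuous | split; exact: derivable_cst].
Qed.

End Calculus.

(* A complex manifold is presented by its local holomorphic parametrisations: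
   pairs of an open U in C^n and a map phi : C^n -> X whose restriction to U is
   the inverse of a holomorphic chart (phi is irrelevant outside of U).  The
   record only carries these data; smooth functions and forms are defined from
   them. *)
Record holo_atlas (R : realType) (n : nat) := HoloAtlas {
  points :> Type;
  params : set (set 'CV[R]_n * ('CV[R]_n -> points)) }.

Section BottChern.
Variables (R : realType) (n : nat) (X : holo_atlas R n).
Implicit Types (p q : set 'CV[R]_n * ('CV[R]_n -> X)).

Definition smooth_fun (f : X -> R) :=
  forall p, params p -> smooth_on p.1 (fun z => RtoC (f (p.2 z))).

(* A (1,1)-form is given by its coefficient matrix in each parametrisation
   (irrelevant outside of the domain). *)
Definition form11 := set 'CV[R]_n * ('CV[R]_n -> X) -> 'CV[R]_n -> 'M[CC R]_n.
Implicit Types a b : form11.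

Definition form11_compatible a :=
  forall p q, params p -> params q ->
  forall (W : set 'CV[R]_n) (tau : 'CV[R]_n -> 'CV[R]_n),
    open W -> W `<=` p.1 -> holomorphic_on W tau ->
    (forall z, W z -> q.1 (tau z) /\ q.2 (tau z) = p.2 z) ->
  forall z, W z -> a p z = pullback11 tau (a q) z.

Definition form11_smooth a :=
  forall p, params p -> forall j k, smooth_on p.1 (fun z => a p z j k).

(* As dz_j /\ dzbar_k is conjugate to - dz_k /\ dzbar_j, a real form has
   skew-Hermitian coefficient matrices. *)
Definition form11_real a :=
  forall p, params p -> forall z, p.1 z -> adjoint (a p z) = - a p z.

Definition form11_closed a := forall p, params p -> d_closed_on p.1 (a p).

Definition closed_real_form11 : set form11 :=
  [set a | [/\ form11_compatible a, form11_smooth a,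
               form11_real a & form11_closed a]].

Definition scale_form11 (r : R) a : form11 := fun p z => RtoC r *: a p z.

Lemma closed_real_form11Z r a :
  closed_real_form11 a -> closed_real_form11 (scale_form11 r a).
Proof.
move=> [ca sa ra da]; split.
- move=> p q Xp Xq W tau oW Wp htau tauE z Wz.
  rewrite /scale_form11 (ca _ _ Xp Xq _ _ oW Wp htau tauE _ Wz).
  by rewrite /pullback11 -scalemxAr -scalemxAl.
- move=> p Xp j k.
  rewrite (_ : (fun z => _) = fun z => RtoC r * a p z j k).
    exact/smooth_onZ/sa.
  by apply/funext => z; rewrite mxE.
- move=> p Xp z pz; rewrite /scale_form11 -scalerN -ra //.
  apply/matrixP => j k; rewrite !mxE.
  by case: (a p z k j) => x y /=; apply/eqP; rewrite eq_complex /= !mul0r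
    !subr0 !addr0 mulrN !eqxx.
- move=> p Xp z pz l j k.
  have E j' k' : (fun w => scale_form11 r a p w j' k') =
                 fun w => RtoC r * a p w j' k'.
    by apply/funext => w; rewrite mxE.
  have [d1 d2] := da p Xp z pz l j k.
  by rewrite !E !wirtZ !wirtbarZ d1 d2.
Qed.

Lemma closed_real_form11_0 : closed_real_form11 (fun _ _ => 0).
Proof.
split.
- by move=> *; rewrite /pullback11 mulmx0 mul0mx.
- move=> p Xp j k; rewrite (_ : (fun z => _) = fun=> 0); last first.
    by apply/funext => z; rewrite mxE.
  exact: smooth_on0.
- move=> p Xp z pz; apply/matrixP => j k.
  by rewrite !mxE oppr0; apply/eqP; rewrite eq_complex /= oppr0 !eqxx.
- move=> p Xp z pz l j k.
  have E j' k' : (fun w : 'CV[R]_n => (0 : 'M[CC R]_n) j' k') = fun=> 0.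
    by apply/funext => w; rewrite mxE.
  by rewrite !E.
Qed.

(* b - a = sqrt(-1) ddbar f for some smooth real function f on X. *)
Definition bc_equiv a b :=
  exists2 f : X -> R, smooth_fun f &
  forall p, params p -> forall z, p.1 z ->
    b p z - a p z = Ci R *: ddbar (fun w => RtoC (f (p.2 w))) z.

Definition bc_coset a : set form11 :=
  [set b | closed_real_form11 b /\ bc_equiv a b].

Definition HBC : Type := set_type (bc_coset @` closed_real_form11).

Definition bc_class a (ha : closed_real_form11 a) : HBC :=
  SigSub (mem_set (imageP bc_coset ha)).

Definition bc_zero : HBC := bc_class closed_real_form11_0.

Definition bc_repr (c : HBC) : {a : form11 | closed_real_form11 a & bc_coset a = val c} :=
  cid2 (set_valP c).

Definition bc_scale (r : R) (c : HBC) : HBC :=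
  bc_class (closed_real_form11Z r (s2valP (bc_repr c))).

(* A holomorphic line bundle: total space, projection, scalar multiplication in
   the fibres, and over each parametrisation (U, phi) a set of nowhere vanishing
   holomorphic local frames s : U -> total, s z lying over phi z.  As above, only
   the data are recorded. *)
Record holo_line_bundle := HoloLineBundle {
  total : Type;
  bproj : total -> X;
  bscale : CC R -> total -> total;
  frames : set 'CV[R]_n * ('CV[R]_n -> X) -> set ('CV[R]_n -> total) }.

(* A Hermitian metric, given by the squared norm h v = <v, v>. *)
Definition hermitian_metric (L : holo_line_bundle) (h : total L -> R) :=
  (forall c v, h (bscale c v) = Cabs c ^+ 2 * h v) /\
  forall p (s : 'CV[R]_n -> total L), params p -> frames p s ->
    (forall z, p.1 z -> 0 < h (s z)) /\
    smooth_on p.1 (fun z => RtoC (h (s z))).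

Definition chern_form (L : holo_line_bundle) (h : total L -> R) a :=
  forall p (s : 'CV[R]_n -> total L), params p -> frames p s ->
  forall z, p.1 z ->
    a p z = - (Ci R / RtoC (2 * pi)) *: ddbar (fun w => RtoC (ln (h (s w)))) z.

Definition is_c1 (L : holo_line_bundle) : set HBC :=
  [set c | exists (h : total L -> R) (a : form11) (ha : closed_real_form11 a),
    [/\ hermitian_metric h, chern_form h a & c = bc_class ha]].

(* The class of the Chern form of a chosen Hermitian metric; as metrics exist and
   the class does not depend on the metric, the default value is never used. *)
Definition c1 (L : holo_line_bundle) : HBC := xget bc_zero (is_c1 L).

End BottChern.

Section Hopf.
Variables (R : realType) (n : nat).

Definition biholomorphism (g : 'CV[R]_n -> 'CV[R]_n) :=
  exists g' : 'CV[R]_n -> 'CV[R]_n,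
    [/\ holomorphic_on setT g, holomorphic_on setT g',
        cancel g g' & cancel g' g].

(* The iterates of g converge to 0 uniformly on compact subsets. *)
Definition contraction (g : 'CV[R]_n -> 'CV[R]_n) :=
  forall K U : set 'CV[R]_n, compact K -> nbhs (0 : 'CV[R]_n) U ->
  \forall k \near \oo, iter k g @` K `<=` U.

Definition hopf_generator (g : 'CV[R]_n -> 'CV[R]_n) :=
  [/\ biholomorphism g, g 0 = 0 & contraction g].

Definition punctured := {z : 'CV[R]_n | z != 0}.

Variable g : 'CV[R]_n -> 'CV[R]_n.

(* For bijective g this is membership in the same orbit of the cyclic group
   generated by g: the exponent is i - j. *)
Definition hopf_rel (z w : punctured) : bool :=
  `[< exists i j : nat, iter i g (val z) = iter j g (val w) >].

Lemma hopf_equiv : equiv_class_of hopf_rel.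
Proof.
split.
- by move=> z; apply/asboolP; exists 0%N, 0%N.
- by move=> z w; apply/asboolP/asboolP => -[i [j e]]; exists j, i.
- move=> y x z /asboolP[i [j e]] /asboolP[i' [j' e']].
  apply/asboolP; exists (i' + i)%N, (j + j')%N.
  by rewrite !iterD e -iterD addnC iterD e'.
Qed.
Canonical hopf_equivRel := EquivRelPack hopf_equiv.

Definition hopf_space : Type := {eq_quot hopf_equivRel}.

Definition hopf_pi (z : punctured) : hopf_space := \pi_{eq_quot hopf_equivRel} z.

(* The parametrisations are the restrictions of the quotient map to the open
   sets on which it is injective. *)
Definition hopf_manifold : holo_atlas R n := @HoloAtlas R n hopf_space
  [set p : set 'CV[R]_n * ('CV[R]_n -> hopf_space) | [/\ open p.1, ~ p.1 0, set_inj p.1 p.2 &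
     forall z : punctured, p.1 (val z) -> p.2 (val z) = hopf_pi z]].

Variable delta : CC R.

(* The equivalence relation generated by (z, v) ~ (g z, delta v), delta != 0. *)
Definition flat_rel (x y : punctured * CC R) : bool :=
  `[< exists i j : nat, iter i g (val x.1) = iter j g (val y.1) /\
        delta ^+ i * x.2 = delta ^+ j * y.2 >].

Lemma flat_equiv : equiv_class_of flat_rel.
Proof.
split.
- by move=> x; apply/asboolP; exists 0%N, 0%N.
- by move=> x y; apply/asboolP/asboolP => -[i [j [e e']]]; exists j, i.
- move=> y x z /asboolP[i [j [e f]]] /asboolP[i' [j' [e' f']]].
  apply/asboolP; exists (i' + i)%N, (j + j')%N; split.
    by rewrite !iterD e -iterD addnC iterD e'.
  by rewrite !exprD -mulrA f mulrCA f' mulrA.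
Qed.
Canonical flat_equivRel := EquivRelPack flat_equiv.

Definition flat_total : Type := {eq_quot flat_equivRel}.

Definition flat_pi (x : punctured * CC R) : flat_total :=
  \pi_{eq_quot flat_equivRel} x.

Definition flat_repr (t : flat_total) : punctured * CC R :=
  repr (t : {eq_quot flat_equivRel}).

(* The frames are the local sections z |-> [(z, 1)]. *)
Definition flat_bundle : holo_line_bundle hopf_manifold :=
  @HoloLineBundle R n hopf_manifold flat_total
    (fun t => hopf_pi (flat_repr t).1)
    (fun c t => flat_pi ((flat_repr t).1, c * (flat_repr t).2))
    (fun p => [set s : 'CV[R]_n -> flat_total | forall z : punctured,
       p.1 (val z) -> s (val z) = flat_pi (z, 1)]).

Lemma hopf_piE (z w : punctured) : (hopf_pi z = hopf_pi w) <-> hopf_rel z w.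
Proof. by split=> [/eqmodP|H]//; apply/eqmodP. Qed.

Lemma flat_piE (x y : punctured * CC R) : (flat_pi x = flat_pi y) <-> flat_rel x y.
Proof. by split=> [/eqmodP|H]//; apply/eqmodP. Qed.

Lemma flat_reprP (x : punctured * CC R) : flat_rel (flat_repr (flat_pi x)) x.
Proof. by apply/flat_piE; rewrite /flat_pi /flat_repr reprK. Qed.

Lemma bproj_flat (z : punctured) (v : CC R) :
  bproj (flat_pi (z, v) : total flat_bundle) = hopf_pi z.
Proof.
apply/hopf_piE; have /asboolP[i [j [e _]]] := flat_reprP (z, v).
by apply/asboolP; exists i, j.
Qed.

Lemma bscale_flat (z : punctured) (v c : CC R) :
  bscale c (flat_pi (z, v) : total flat_bundle) = flat_pi (z, c * v).
Proof.
apply/flat_piE; have /asboolP[i [j [e f]]] := flat_reprP (z, v).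
by apply/asboolP; exists i, j; split=> //=; rewrite !(mulrCA _ c) f.
Qed.

End Hopf.

(* Main.v *)
Require Import Defs.
From mathcomp Require Import all_boot all_order all_algebra.
From mathcomp Require Import generic_quotient complex.
From mathcomp Require Import all_classical all_reals all_analysis.
From mathcomp Require Import ring.

Set Implicit Arguments.
Unset Strict Implicit.
Unset Printing Implicit Defensive.

Import Order.TTheory GRing.Theory Num.Theory.
Import numFieldNormedType.Exports.

Local Open Scope classical_set_scope.
Local Open Scope ring_scope.
Local Open Scope complex_scope.
Local Open Scope quotient_scope.

(** Everything comes from one construction on metrics.  A Hermitian metric h on
L_delta is the same thing as a positive function H on the punctured space,
H z = h [(z, 1)], with H (gamma z) = |delta|^(-2) H z: [metric_unit_vector].  If
ln |delta2| = r ln |delta1|, then the power H^r = exp (r ln H) of a metric on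
L_delta1 picks up the factor |delta2|^(-2), so it is a metric on L_delta2; as
ln (H^r) = r ln H, its Chern form is r times that of H.  Hence r times a class
represented by a Chern form of L_delta1 is represented by a Chern form of
L_delta2: [is_c1_scale].

The class does not depend on the metric: for two metrics h, h' on the same
L_delta the factors cancel in ln H' - ln H, which descends to a smooth function
f on the quotient, and the Chern forms differ by - (i / 2 pi) ddbar f:
[bc_equiv_chern_form].  Together these give c_1(L_delta2) = r c_1(L_delta1)
when |delta1| is not 1: [c1_flat_scale].  Taking powers goes both ways, so
L_delta1 carries a metric exactly when L_delta2 does (unless |delta2| = 1), and
no metric has to be exhibited there.  When |delta| = 1 the metric |v|^2 is
flat and c_1(L_delta) = 0: [c1_flat_unit].  Both statements follow by choosing
r = ln |delta2| / ln |delta1|, respectively r = 1.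

The analytic input is that smooth functions are stable under sums, products and
composition with exp and ln, and that i ddbar is additive and local on them.
Only real-valued functions occur, so this calculus is carried out over the reals
([smoothR]) and transported by [smooth_onP] and [ddbarE]. *)

(** * Reals inside the complex numbers *)

Section ComplexTopology.
Variable R : realType.

Lemma RtoC_continuous : continuous (@RtoC R).
Proof.
move=> x; apply/cvgrPdist_lt => -[e e'].
rewrite ltcE /= => /andP[/eqP-> e0].
near=> y.
suff : `|x - y| < e by rewrite -ltcR /RtoC -rmorphB normc_def /= expr0n addr0 sqrtr_sqr.
by near: y; exact: (@cvgrPdist_lt _ _ _ _ _ id x).1.
Unshelve. all: by end_near. Qed.

Lemma Re_continuous : continuous (@complex.Re R : CC R -> R).
Proof.
move=> x; apply/(@cvgrPdist_lt _ _ _ (nbhs (x : CC R))) => e e0.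
near=> y.
have xy : `|x - y| < RtoC e.
  near: y; apply: (@cvgrPdist_lt _ _ _ (nbhs x) _ id x).1 => //.
  by rewrite /RtoC ltcR.
rewrite -ltcR; apply: le_lt_trans xy.
by rewrite -raddfB; exact: normc_ge_Re.
Unshelve. all: by end_near. Qed.

Lemma RtoC_Ci (a b : R) : RtoC a + Ci R * RtoC b = a +i* b.
Proof. by apply/eqP; rewrite eq_complex /= !mul0r !mul1r subr0 addr0 2!add0r !eqxx. Qed.

Lemma continuous_RtoC (T : topologicalType) (u : T -> R) (z : T) :
  {for z, continuous (fun w => RtoC (u w))} <-> {for z, continuous u}.
Proof.
split=> cu; last exact: continuous_comp cu (@RtoC_continuous _).
exact: (continuous_comp cu (@Re_continuous _)).
Qed.

End ComplexTopology.

(** * Smooth real functions on open subsets of C^n *)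

Section RealSmooth.
Variables (R : realType) (n : nat).
Implicit Types (U : set 'CV[R]_n) (u w : 'CV[R]_n -> R) (z v : 'CV[R]_n).

Definition line u z v (t : R) : R := u (z + RtoC t *: v).

Definition rder v u z : R := derive1 (line u z v) 0.

(** Order-k truncation of smoothness, set up for induction on the number of
derivatives; the order 0 imposes nothing, so that continuity first appears at
order 1 and all base cases are trivial. *)
Fixpoint Csmooth k U u : Prop :=
  if k is k'.+1 then
    [/\ forall z, U z -> {for z, continuous u},
        forall z v, U z -> derivable (line u z v) 0 1 &
        forall v, Csmooth k' U (rder v u)]
  else True.

Definition smoothR U u := forall k, Csmooth k U u.

Lemma CsmoothW k U u : Csmooth k.+1 U u -> Csmooth k U u.
Proof.
elim: k u => [|k IH] u [cu du Du] //.
by split=> // v; exact: IH.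
Qed.

Lemma Csmooth_rder k U u v : Csmooth k.+1 U u -> Csmooth k U (rder v u).
Proof. by case=> _ _; apply. Qed.

Lemma rderiv_RtoC v u :
  rderiv v (fun z => RtoC (u z)) = (fun z => RtoC (rder v u z)).
Proof. by apply/funext => z; rewrite /rderiv /rder derive1_cst. Qed.

Lemma foldr_rderiv_RtoC s u :
  foldr (@rderiv R n) (fun z => RtoC (u z)) s =
  (fun z => RtoC (foldr rder u s z)).
Proof. by elim: s => //= v s ->; rewrite rderiv_RtoC. Qed.

(** The lists of directions in [smooth_on] are consumed from the right, which is
the innermost derivative, whereas [Csmooth] peels off that same derivative
first; this is why lists are split at their last element. *)
Lemma smooth_onP U u : smooth_on U (fun z => RtoC (u z)) <-> smoothR U u.
Proof.
split=> [su k|su s g z Uz].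
  have {su} : forall s z, U z ->
      {for z, continuous (foldr rder u s)} /\
      forall v, derivable (line (foldr rder u s) z v) 0 1.
    move=> s z Uz; have := su s z Uz; rewrite foldr_rderiv_RtoC.
    by case=> /continuous_RtoC cu du; split=> // v; case: (du v).
  elim: k u => [//|k IH] u su.
  split=> [z /(su [::])[]//|z v /(su [::])[_]|v]; first exact.
  by apply: IH => s z Uz; have := su (rcons s v) z Uz; rewrite foldr_rcons.
rewrite {}/g foldr_rderiv_RtoC.
suff [cu du] : {for z, continuous (foldr rder u s)} /\
    forall v, derivable (line (foldr rder u s) z v) 0 1.
  split; first exact/continuous_RtoC.
  by move=> v; split; [exact: du | exact: derivable_cst].
have {su} := su (size s).+1.
elim/last_ind: s u => [|s v IH] u.
  by case=> cu du _; split=> [|v]; [exact: cu | exact: du].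
by rewrite size_rcons foldr_rcons => -[_ _ /(_ v)]; exact: IH.
Qed.

Lemma line_near U z v : open U -> U z -> \forall t \near (0 : R), U (z + RtoC t *: v).
Proof.
move=> oU Uz.
have /= : (z + RtoC t *: v) @[t --> (0 : R)] --> z.
  rewrite -[X in _ --> X]addr0 -(scale0r v).
  apply: cvgD; first exact: cvg_cst.
  apply: cvgZr_tmp => //.
  exact: RtoC_continuous.
by apply; exact: (open_nbhs_nbhs (conj oU Uz)).
Qed.


Lemma line_eq_near U u w z v : open U -> U z -> {in U, u =1 w} ->
  {near (0 : R), line u z v =1 line w z v}.
Proof.
move=> oU Uz uw; apply: filterS (line_near v oU Uz) => t Ut.
by apply: uw; exact: mem_set.
Qed.

Lemma rder_eq U u w v : open U -> {in U, u =1 w} ->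
  {in U, rder v u =1 rder v w}.
Proof.
move=> oU uw z /set_mem Uz; rewrite /rder !derive1E.
by apply: near_eq_derive; apply: (line_eq_near v oU Uz uw).
Qed.

Lemma eq_continuous_at U u w z : open U -> U z -> {in U, u =1 w} ->
  {for z, continuous u} -> {for z, continuous w}.
Proof.
move=> oU Uz uw cu; rewrite /prop_for /continuous_at -(uw z (mem_set Uz)).
apply: cvg_trans cu; apply: (@near_eq_cvg _ _ (nbhs z)).
apply: filterS (open_nbhs_nbhs (conj oU Uz)) => y Uy.
by apply: uw; exact: mem_set.
Qed.

Lemma eq_Csmooth k U u w : open U -> {in U, u =1 w} ->
  Csmooth k U u -> Csmooth k U w.
Proof.
move=> oU; elim: k u w => [//|k IH] u w uw [cu du Du]; split=> [z Uz|z v Uz|v].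
- exact: eq_continuous_at oU Uz uw (cu z Uz).
- by apply: near_eq_derivable (du z v Uz); exact: (line_eq_near v oU Uz uw).
- by apply: IH (Du v); exact: rder_eq.
Qed.

Lemma line0 u z v : line u z v 0 = u z.
Proof. by rewrite /line scale0r addr0. Qed.

Lemma is_derive_line k U u z v : Csmooth k.+1 U u -> U z ->
  is_derive (0 : R) 1 (line u z v) (rder v u z).
Proof.
move=> [_ du _] Uz; rewrite /rder derive1E.
exact/derivableP/du.
Qed.

Lemma is_derive_rder u z v (d : R) :
  is_derive (0 : R) 1 (line u z v) d -> rder v u z = d.
Proof. by move=> [_ <-]; rewrite /rder derive1E. Qed.

Lemma rderD k U u w z v : Csmooth k.+1 U u -> Csmooth k.+1 U w -> U z ->
  rder v (fun z => u z + w z) z = rder v u z + rder v w z.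
Proof.
move=> su sw Uz; apply: is_derive_rder.
by have := is_deriveD (is_derive_line v su Uz) (is_derive_line v sw Uz).
Qed.

Lemma CsmoothD k U u w : open U -> Csmooth k U u -> Csmooth k U w ->
  Csmooth k U (fun z => u z + w z).
Proof.
move=> oU; elim: k u w => [//|k IH] u w su sw; split=> [z Uz|z v Uz|v].
- apply: (@cvgD _ _ _ (nbhs z)); first by case: su => /(_ z Uz).
  by case: sw => /(_ z Uz).
- by have [] := is_deriveD (is_derive_line v su Uz) (is_derive_line v sw Uz).
- apply: (@eq_Csmooth _ _ (fun z => rder v u z + rder v w z)) => //.
    by move=> z /set_mem Uz; rewrite (rderD _ su sw Uz).
  by apply: IH; exact: Csmooth_rder.
Qed.

Lemma rderM k U u w z v : Csmooth k.+1 U u -> Csmooth k.+1 U w -> U z ->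
  rder v (fun z => u z * w z) z = u z * rder v w z + w z * rder v u z.
Proof.
move=> su sw Uz; apply: is_derive_rder; rewrite -{1}(line0 u z v) -{1}(line0 w z v).
by have := is_deriveM (is_derive_line v su Uz) (is_derive_line v sw Uz).
Qed.

Lemma CsmoothM k U u w : open U -> Csmooth k U u -> Csmooth k U w ->
  Csmooth k U (fun z => u z * w z).
Proof.
move=> oU; elim: k u w => [//|k IH] u w su sw; split=> [z Uz|z v Uz|v].
- apply: (@cvgM _ _ (nbhs z)); first by case: su => /(_ z Uz).
  by case: sw => /(_ z Uz).
- by have [] := is_deriveM (is_derive_line v su Uz) (is_derive_line v sw Uz).
- apply: (@eq_Csmooth _ _ (fun z => u z * rder v w z + w z * rder v u z)) => //.
    by move=> z /set_mem Uz; rewrite (rderM _ su sw Uz).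
  apply: CsmoothD => //; apply: IH.
  - exact: CsmoothW.
  - exact: Csmooth_rder.
  - exact: CsmoothW.
  - exact: Csmooth_rder.
Qed.

(** The whole sequence of derivatives of the outer function is carried along,
because the chain rule replaces phi_i by phi_(i+1). *)
Lemma Csmooth_comp (D : set R) (phi : nat -> R -> R) :
  (forall i x, D x -> is_derive x 1 (phi i) (phi i.+1 x)) ->
  forall k i U u, open U -> (forall z, U z -> D (u z)) ->
  Csmooth k U u -> Csmooth k U (fun z => phi i (u z)).
Proof.
move=> dphi k i U u oU Du; elim: k i => [//|k IH] i su.
have dcomp z v : U z ->
    is_derive (0 : R) 1 (line (fun z => phi i (u z)) z v)
      (phi i.+1 (u z) * rder v u z).
  move=> Uz; apply: is_derive1_comp (is_derive_line v su Uz).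
  by rewrite line0; exact/dphi/Du.
split=> [z Uz|z v Uz|v].
- apply: continuous_comp; first by case: su => /(_ z Uz).
  apply: differentiable_continuous; apply/derivable1_diffP.
  by have [] := dphi i _ (Du z Uz).
- by have [] := dcomp z v Uz.
apply: (@eq_Csmooth _ _ (fun z => phi i.+1 (u z) * rder v u z)) => //.
  by move=> z /set_mem Uz; rewrite (is_derive_rder (dcomp z v Uz)).
apply: CsmoothM => //; first exact/IH/CsmoothW.
exact: Csmooth_rder.
Qed.

Lemma smoothR_expR U u : open U -> smoothR U u -> smoothR U (fun z => expR (u z)).
Proof.
by move=> oU su k; apply: (@Csmooth_comp setT (fun=> expR) _ k 0%N).
Qed.

Definition ln_iterated_derivative k : R -> R :=
  if k is k'.+1 then (fun x => (-1) ^+ k' * (k'`!)%:R * x^-1 ^+ k'.+1) else @ln R.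

Lemma smoothR_ln U u : open U -> (forall z, U z -> 0 < u z) ->
  smoothR U u -> smoothR U (fun z => ln (u z)).
Proof.
move=> oU u0 su k.
apply: (@Csmooth_comp [set x | 0 < x] ln_iterated_derivative _ k 0%N) => //.
move=> [|i] x /= x0.
  by rewrite expr0 fact0 !mul1r expr1; exact: is_derive1_ln.
have dV := is_deriveX i.+1 (is_deriveV (lt0r_neq0 x0) (is_derive_id x (1 : R))).
have := is_deriveZ ((-1) ^+ i * (i`!)%:R) dV.
set d := (X in is_derive _ _ _ X -> _); move=> H.
suff -> : (-1) ^+ i.+1 * (i.+1`!)%:R * x^-1 ^+ i.+2 = d.
  by rewrite exprfctE in H.
rewrite /d /= /GRing.scale /= factS natrM !exprS expr0 !invfM invr1.
by move: (x^-1) (x^-1 ^+ i) ((-1) ^+ i) (i.+1%:R) ((i`!)%:R) => *; ring.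
Qed.

Lemma CsmoothZ k (r : R) U u : open U -> Csmooth k U u ->
  Csmooth k U (fun z => r * u z).
Proof.
move=> oU; apply: (@Csmooth_comp setT
  (fun i x => if i is i'.+1 then if i' is 0%N then r else 0 else r * x) _ k 0%N) => //.
move=> [|[|i]] x _; try exact: is_derive_cst.
have := is_deriveZ r (is_derive_id x (1 : R)).
by rewrite /GRing.scale /= mulr1.
Qed.

Lemma eq_smoothR U u w : open U -> {in U, u =1 w} -> smoothR U u -> smoothR U w.
Proof. by move=> oU uw su k; exact: eq_Csmooth uw (su k). Qed.

Lemma smoothRD U u w : open U -> smoothR U u -> smoothR U w ->
  smoothR U (fun z => u z + w z).
Proof. by move=> oU su sw k; exact: CsmoothD. Qed.

Lemma smoothRZ U (r : R) u : open U -> smoothR U u -> smoothR U (fun z => r * u z).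
Proof. by move=> oU su k; exact: CsmoothZ. Qed.

Lemma smoothR_cst U (c : R) : open U -> smoothR U (fun=> c).
Proof.
move=> oU k; elim: k c => [//|k IH] c; split=> [z _|z v _|v].
- exact: cst_continuous.
- exact: derivable_cst.
- by rewrite (_ : rder v _ = fun=> 0)//; apply/funext => z; exact: derive1_cst.
Qed.

(** * The operator ddbar on real functions *)

Definition hessian u z (a b : 'CV[R]_n) : R := rder a (rder b u) z.

Lemma eq_hessian U u w z : open U -> {in U, u =1 w} -> U z ->
  hessian u z = hessian w z.
Proof.
move=> oU uw /mem_set Uz; apply/funext => a; apply/funext => b.
have buw := rder_eq b oU uw.
exact: (rder_eq a oU buw Uz).
Qed.

Lemma hessianD U u w z : open U -> smoothR U u -> smoothR U w -> U z ->
  hessian (fun y => u y + w y) z = fun a b => hessian u z a b + hessian w z a b.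
Proof.
move=> oU su sw Uz; apply/funext => a; apply/funext => b; rewrite /hessian.
rewrite (@rder_eq U _ (fun y => rder b u y + rder b w y)) ?inE//.
  by apply: rderD Uz; [exact/Csmooth_rder/(su 2)|exact/Csmooth_rder/(sw 2)].
by move=> y /set_mem Uy; exact: rderD (su 1) (sw 1) Uy.
Qed.

(** The matrix of ddbar u is real-linear in the real Hessian of u, and this is
the linear map; additivity and locality of ddbar are thus reduced to the same
properties of second directional derivatives. *)
Definition levi (Q : 'CV[R]_n -> 'CV[R]_n -> R) : 'M[CC R]_n :=
  \matrix_(j, k)
    let e l := basis_vec R (l : 'I_n) in let ie l := Ci R *: e l in
    (RtoC 2^-1 * (Q (e j) (e k) +i* Q (e j) (ie k))
     - Ci R * (RtoC 2^-1 * (Q (ie j) (e k) +i* Q (ie j) (ie k)))) / 2.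

Lemma leviD Q Q' : levi (fun a b => Q a b + Q' a b) = levi Q + levi Q'.
Proof.
apply/matrixP => j k; rewrite !mxE.
have cD (x x' y y' : R) :
  (x + x') +i* (y + y') = ((x +i* y) + (x' +i* y') : CC R) by [].
by cbv zeta; rewrite !cD; move: (_ +i* _) (_ +i* _) (_ +i* _) (_ +i* _) => *; ring.
Qed.

Lemma ddbarE u z : ddbar (fun y => RtoC (u y)) z = levi (hessian u z).
Proof.
apply/matrixP => j k.
pose e (l : 'I_n) := basis_vec R l; pose ie l := Ci R *: e l.
rewrite !mxE /wirt.
pose q y : CC R := rder (e k) u y +i* rder (ie k) u y.
have -> : wirtbar k (fun y => RtoC (u y)) = fun y => RtoC 2^-1 * q y.
  apply/funext => y; rewrite /wirtbar !rderiv_RtoC mulrC; congr (_ * _).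
    by rewrite /RtoC fmorphV rmorph_nat.
  exact: RtoC_Ci.
by rewrite (rderivZ (e j) _ q) (rderivZ (ie j) _ q).
Qed.

Lemma eq_ddbar U u w z : open U -> {in U, u =1 w} -> U z ->
  ddbar (fun y => RtoC (u y)) z = ddbar (fun y => RtoC (w y)) z.
Proof.
by move=> oU uw Uz; rewrite ddbarE (eq_hessian oU uw Uz) -ddbarE.
Qed.

Lemma ddbarD U u w z : open U -> smoothR U u -> smoothR U w -> U z ->
  ddbar (fun y => RtoC (u y + w y)) z =
  ddbar (fun y => RtoC (u y)) z + ddbar (fun y => RtoC (w y)) z.
Proof.
move=> oU su sw Uz; rewrite (ddbarE (fun y => u y + w y)).
by rewrite (hessianD oU su sw Uz) leviD -!ddbarE.
Qed.

Lemma ddbarZ (r : R) u z :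
  ddbar (fun y => RtoC (r * u y)) z = RtoC r *: ddbar (fun y => RtoC (u y)) z.
Proof.
have -> : (fun y => RtoC (r * u y)) = (fun y => RtoC r * RtoC (u y)).
  by apply/funext => y; rewrite /RtoC rmorphM.
apply/matrixP => j k; rewrite !mxE -wirtZ; congr (wirt j _ z).
by apply/funext => y; exact: wirtbarZ.
Qed.

Lemma ddbar0 z : ddbar (fun=> RtoC 0) z = 0 :> 'M[CC R]_n.
Proof.
have -> : (fun=> RtoC 0) = (fun=> RtoC (0 * 0)) :> ('CV[R]_n -> CC R).
  by apply/funext => y; rewrite mul0r.
by rewrite (ddbarZ 0 (fun=> 0)) scale0r.
Qed.

End RealSmooth.

(** * Bott-Chern classes *)

Section BottChernClasses.
Variables (R : realType) (n : nat) (X : holo_atlas R n).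
Hypothesis openX : forall p, params (h := X) p -> open p.1.
Implicit Types a b c : form11 X.

Lemma bc_equiv_eq a b :
  (forall p, params p -> forall z, p.1 z -> a p z = b p z) -> bc_equiv a b.
Proof.
move=> ab; exists (fun=> 0) => p Xp; first exact: smooth_on0.
by move=> z pz; rewrite ab// subrr ddbar0 scaler0.
Qed.

Lemma bc_equivZ (r : R) a b :
  bc_equiv a b -> bc_equiv (scale_form11 r a) (scale_form11 r b).
Proof.
move=> [f sf fE]; exists (fun x => r * f x) => p Xp.
  by apply/smooth_onP/smoothRZ; [exact: openX|exact/smooth_onP/sf].
by move=> z pz; rewrite -scalerBr fE// ddbarZ !scalerA mulrC.
Qed.

Lemma bc_equiv_sym a b : bc_equiv a b -> bc_equiv b a.
Proof.
move=> [f sf fE]; exists (fun x => -1 * f x) => p Xp.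
  by apply/smooth_onP/smoothRZ; [exact: openX|exact/smooth_onP/sf].
move=> z pz; rewrite -opprB fE// ddbarZ /RtoC rmorphN1.
by rewrite scaleN1r scalerN.
Qed.

Lemma bc_equiv_trans a b c : bc_equiv a b -> bc_equiv b c -> bc_equiv a c.
Proof.
move=> [f sf fE] [f' sf' fE']; exists (fun x => f x + f' x) => p Xp.
  apply/smooth_onP/smoothRD; [exact: openX|exact/smooth_onP/sf|].
  exact/smooth_onP/sf'.
move=> z pz; have fpE := fE p Xp z pz; have f'pE := fE' p Xp z pz.
have D := ddbarD (openX Xp) ((smooth_onP _ _).1 (sf p Xp))
  ((smooth_onP _ _).1 (sf' p Xp)) pz.
rewrite (congr1 (fun M => Ci R *: M) D) scalerDr.
have -> : c p z - a p z = (b p z - a p z) + (c p z - b p z).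
  by rewrite [RHS]addrC addrA subrK.
by rewrite fpE f'pE.
Qed.

Lemma bc_class_eqP a b (ha : closed_real_form11 a) (hb : closed_real_form11 b) :
  bc_class ha = bc_class hb <-> bc_equiv a b.
Proof.
split=> [/(congr1 val) /= ab|ab].
  by have [] : bc_coset a b by rewrite ab; split=> //; exact: bc_equiv_eq.
apply: val_inj; apply/seteqP; split=> d [hd]; split=> //.
  exact: bc_equiv_trans (bc_equiv_sym ab) _.
exact: bc_equiv_trans ab _.
Qed.

Lemma bc_classP (x : HBC X) : exists a (ha : closed_real_form11 a), x = bc_class ha.
Proof.
have [a ha ax] := bc_repr x.
by exists a, ha; apply: val_inj.
Qed.

(** [bc_scale] works on a chosen representative; the outcome is independent of
the choice since scaling respects [bc_equiv]. *)
Lemma bc_scale_class (r : R) a (ha : closed_real_form11 a) :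
  bc_scale r (bc_class ha) = bc_class (closed_real_form11Z r ha).
Proof.
rewrite /bc_scale; case: (bc_repr _) => b hb /= ba; apply/bc_class_eqP/bc_equivZ.
by have [] : bc_coset b a by rewrite ba; split=> //; exact: bc_equiv_eq.
Qed.

Lemma bc_scale_scale (r s : R) (x : HBC X) :
  bc_scale r (bc_scale s x) = bc_scale (r * s) x.
Proof.
have [a [ha ->]] := bc_classP x; rewrite !bc_scale_class.
apply/bc_class_eqP/bc_equiv_eq => p Xp z pz.
by rewrite /scale_form11 scalerA /RtoC rmorphM.
Qed.

Lemma bc_scale1 (x : HBC X) : bc_scale 1 x = x.
Proof.
have [a [ha ->]] := bc_classP x; rewrite !bc_scale_class.
by apply/bc_class_eqP/bc_equiv_eq => p Xp z pz; rewrite /scale_form11 scale1r.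
Qed.

Lemma bc_scale0 (x : HBC X) : bc_scale 0 x = bc_zero X.
Proof.
have [a [ha ->]] := bc_classP x; rewrite !bc_scale_class.
by apply/bc_class_eqP/bc_equiv_eq => p Xp z pz; rewrite /scale_form11 scale0r.
Qed.

Lemma bc_scale_zero (r : R) : bc_scale r (bc_zero X) = bc_zero X.
Proof. by rewrite -(bc_scale0 (bc_zero X)) bc_scale_scale mulr0. Qed.

End BottChernClasses.

(** * Metrics on flat line bundles over a Hopf manifold *)

Section FlatBundles.
Variables (R : realType) (n : nat) (g : 'CV[R]_n -> 'CV[R]_n).
Local Notation X := (hopf_manifold g).
Local Notation pt := (@punctured R n).
Implicit Types (z w : pt) (delta : CC R).

Lemma hopf_open p : params (h := X) p -> open p.1.
Proof. by case. Qed.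

Lemma hopf_param p z : params (h := X) p -> p.1 (val z) -> p.2 (val z) = hopf_pi g z.
Proof. by case=> _ _ _; apply. Qed.

Definition hopf_repr (x : X) : pt := repr (x : {eq_quot hopf_equivRel g}).

Lemma hopf_reprP z : hopf_rel g (hopf_repr (hopf_pi g z)) z.
Proof. by apply/hopf_piE; rewrite /hopf_pi /hopf_repr reprK. Qed.

Lemma Cabs_eq0 delta : (Cabs delta == 0) = (delta == 0).
Proof.
apply/eqP/eqP => [/Normc.eq0_normc//|->]; exact: Normc.normc0.
Qed.

Lemma Cabs_gt0 delta : delta != 0 -> 0 < Cabs delta.
Proof.
move=> d0; rewrite lt_def Cabs_eq0 d0 /=.
by case: delta {d0} => a b; exact: sqrtr_ge0.
Qed.

Lemma CabsM (a b : CC R) : Cabs (a * b) = Cabs a * Cabs b.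
Proof. exact: Normc.normcM. Qed.

Lemma CabsX (a : CC R) k : Cabs (a ^+ k) = Cabs a ^+ k.
Proof.
elim: k => [|k IH]; first by rewrite !expr0; exact: Normc.normc1.
by rewrite !exprS CabsM IH.
Qed.

Lemma Cabs1 : Cabs (1 : CC R) = 1.
Proof. exact: Normc.normc1. Qed.

Section OneBundle.
Variables (delta : CC R) (delta0 : delta != 0).
Local Notation L := (flat_bundle g delta).

Definition unit_vector z : Defs.total L := flat_pi g delta (z, 1).

(** If gamma^i z = gamma^j w then [(z, 1)] = delta^(i - j) [(w, 1)].  The powers
are kept on both sides because i - j may be negative. *)
Lemma metric_unit_vector (h : Defs.total L -> R) z w i j :
  (forall c v, h (bscale c v) = Cabs c ^+ 2 * h v) ->
  iter i g (val z) = iter j g (val w) ->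
  (Cabs delta ^+ j) ^+ 2 * h (unit_vector z) =
  (Cabs delta ^+ i) ^+ 2 * h (unit_vector w).
Proof.
move=> hZ zw.
have -> : unit_vector z = bscale (delta ^+ i / delta ^+ j) (unit_vector w).
  rewrite /unit_vector bscale_flat; apply/flat_piE/asboolP; exists i, j.
  by rewrite /= !mulr1 mulrC divfK// expf_neq0.
rewrite hZ mulrA; congr (_ * _); rewrite -!CabsX -CabsM -exprMn; congr (Cabs (_ ^+ 2)).
by rewrite mulrC divfK// expf_neq0.
Qed.

(** The difference on the right depends on delta, i and j, but not on the metric:
this makes ln H' - ln H invariant.  Positivity at one point of the orbit is
transferred to the others, since it is known only at points lying in the domain
of a parametrisation. *)
Lemma ln_metric_unit_vector (h : Defs.total L -> R) z w i j :
  (forall c v, h (bscale c v) = Cabs c ^+ 2 * h v) ->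
  iter i g (val z) = iter j g (val w) -> 0 < h (unit_vector w) ->
  0 < h (unit_vector z) /\
  ln (h (unit_vector z)) - ln (h (unit_vector w)) =
  (i%:R - j%:R) * (2 * ln (Cabs delta)).
Proof.
move=> hZ zw w0; have E := metric_unit_vector hZ zw.
have d0 k : 0 < (Cabs delta ^+ k) ^+ 2 by rewrite !exprn_gt0// Cabs_gt0.
have lnd k : ln ((Cabs delta ^+ k) ^+ 2) = k%:R * (2 * ln (Cabs delta)).
  rewrite !lnXn ?exprn_gt0 ?Cabs_gt0//.
  by rewrite mulrA -natrM mulr_natl mulrnA.
have z0 : 0 < h (unit_vector z) by rewrite -(pmulr_rgt0 _ (d0 j)) E mulr_gt0.
split=> //; move/(congr1 (@ln R)): E.
rewrite [LHS]lnM ?posrE// [RHS]lnM ?posrE// !lnd => E.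
rewrite mulrBl.
by apply/eqP; rewrite subr_eq addrAC -E addrAC subrr add0r.
Qed.

(** The point z0 only provides a value at the origin, where z |-> [(z, 1)] is
not defined. *)
Lemma unit_frame p (z0 : pt) : params (h := X) p ->
  frames (h := L) p (fun y => unit_vector (insubd z0 y)).
Proof. by move=> Xp z pz; rewrite valKd. Qed.

Lemma frame_unit_vector p (s : 'CV[R]_n -> Defs.total L) z :
  frames (h := L) p s -> p.1 (val z) -> s (val z) = unit_vector z.
Proof. exact. Qed.

Lemma param_punctured p y : params (h := X) p -> p.1 y -> exists z : pt, y = val z.
Proof.
case=> _ p0 _ _ py; suff y0 : y != 0 by exists (Sub y y0).
by apply/eqP => y0; apply: p0; rewrite -y0.
Qed.

(** The function ln H' - ln H is invariant along the orbits, so it can be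
evaluated at any representative of a point of the quotient; this gives the
potential f of the difference of the two Chern forms. *)
Lemma bc_equiv_chern_form (z0 : pt) (h h' : Defs.total L -> R) (a a' : form11 X) :
  hermitian_metric h -> hermitian_metric h' ->
  chern_form h a -> chern_form h' a' -> bc_equiv a a'.
Proof.
move=> [hZ hP] [h'Z h'P] ha h'a.
pose k : R := - (2 * pi)^-1.
pose s y := unit_vector (insubd z0 y).
pose f (x : X) := k * (ln (h' (unit_vector (hopf_repr x))) +
  -1 * ln (h (unit_vector (hopf_repr x)))).
pose u y := ln (h (s y)); pose u' y := ln (h' (s y)).
have fE p : params p -> {in p.1, (fun y => k * (u' y + -1 * u y)) =1 f \o p.2}.
  move=> Xp y /set_mem py; have [z yz] := param_punctured Xp py.
  move: py; rewrite {}yz => pz.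
  rewrite /= /f (hopf_param Xp pz) /u /u' /s valKd.
  have [h0 _] := hP p s Xp (unit_frame z0 Xp).
  have [h'0 _] := h'P p s Xp (unit_frame z0 Xp).
  move: (h0 _ pz) (h'0 _ pz); rewrite /s valKd => hz h'z.
  have /asboolP[i [j ij]] := hopf_reprP z.
  have [_ E] := ln_metric_unit_vector hZ ij hz.
  have [_ E'] := ln_metric_unit_vector h'Z ij h'z.
  congr (k * _); rewrite !mulN1r; apply/eqP; rewrite -subr_eq0.
  apply/eqP; move: E E' => /eqP; rewrite subr_eq => /eqP -> /eqP.
  by rewrite subr_eq => /eqP ->; ring.
have su (p : set 'CV[R]_n * ('CV[R]_n -> X)) :
    params p -> smoothR p.1 u /\ smoothR p.1 u'.
  move=> Xp; have fs := unit_frame z0 Xp.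
  have [h0 sh] := hP p s Xp fs; have [h'0 sh'] := h'P p s Xp fs.
  by split; apply: smoothR_ln (hopf_open Xp) _ _ => //; exact/smooth_onP.
have suu (p : set 'CV[R]_n * ('CV[R]_n -> X)) :
    params p -> smoothR p.1 (fun y => u' y + -1 * u y).
  move=> Xp; have [s1 s2] := su p Xp; have oX := hopf_open Xp.
  exact: smoothRD oX s2 (smoothRZ _ oX s1).
exists f => p Xp.
  apply/smooth_onP; have oX := hopf_open Xp.
  exact: eq_smoothR oX (fE p Xp) (smoothRZ _ oX (suu p Xp)).
move=> y py; have oX := hopf_open Xp; have [s1 s2] := su p Xp.
have E := eq_ddbar oX (fE p Xp) py.
rewrite -(congr1 (fun M => Ci R *: M) E).
rewrite (congr1 (fun M => Ci R *: M) (ddbarZ k (fun y => u' y + -1 * u y) y)).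
have D := ddbarD oX s2 (smoothRZ (-1) oX s1) py.
rewrite (congr1 (fun M => Ci R *: (RtoC k *: M)) D).
rewrite (congr1 (fun M => Ci R *: (RtoC k *: (_ + M))) (ddbarZ (-1) u y)).
rewrite (ha p s Xp (unit_frame z0 Xp) y py) (h'a p s Xp (unit_frame z0 Xp) y py).
have -> : - (Ci R / RtoC (2 * pi)) = Ci R * RtoC k.
  by rewrite /k /RtoC rmorphN fmorphV mulrN.
by rewrite scalerA -scalerBr /RtoC rmorphN1 scaleN1r.
Qed.

Lemma is_c1_unique (z0 : pt) x y : is_c1 L x -> is_c1 L y -> x = y.
Proof.
move=> [h [a [ha [hh ah ->]]]] [h' [a' [ha' [hh' ah' ->]]]].
apply/(bc_class_eqP hopf_open).
apply: (bc_equiv_chern_form z0 hh hh' ah ah').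
Qed.

(** Converse of [metric_unit_vector]: a function P on the punctured space with
the right equivariance gives the metric [(z, v)] |-> |v|^2 P z. *)
Section WeightMetric.
Variable P : pt -> R.
Hypothesis weightP : forall z w i j, iter i g (val z) = iter j g (val w) ->
  (Cabs delta ^+ j) ^+ 2 * P z = (Cabs delta ^+ i) ^+ 2 * P w.

Definition weight_metric (t : Defs.total L) : R :=
  Cabs (flat_repr t).2 ^+ 2 * P (flat_repr t).1.

Lemma weight_metricE z (v : CC R) :
  weight_metric (flat_pi g delta (z, v)) = Cabs v ^+ 2 * P z.
Proof.
have /asboolP[i [j [/weightP PE vE]]] := flat_reprP g delta (z, v).
rewrite /weight_metric; move: PE vE; move: (flat_repr _) => [w c] /= PE vE.
have d0 k : (Cabs delta ^+ k) ^+ 2 != 0.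
  by rewrite !expf_neq0// Cabs_eq0.
have : (Cabs delta ^+ i) ^+ 2 * Cabs c ^+ 2 = (Cabs delta ^+ j) ^+ 2 * Cabs v ^+ 2.
  by rewrite -!CabsX -!CabsM -!exprMn vE.
move=> cE; apply: (mulfI (d0 j)).
by rewrite [LHS]mulrCA PE [LHS]mulrCA [LHS]mulrA cE -mulrA.
Qed.

Lemma weight_metricZ c t : weight_metric (bscale c t) = Cabs c ^+ 2 * weight_metric t.
Proof. by rewrite [LHS]weight_metricE CabsM exprMn -mulrA. Qed.

Lemma weight_metric_unit_vector z : weight_metric (unit_vector z) = P z.
Proof. by rewrite weight_metricE Cabs1 expr1n mul1r. Qed.

End WeightMetric.

(** On a unitary flat bundle P = 1 is equivariant, and ln 1 = 0. *)
Lemma is_c1_zero : Cabs delta = 1 -> is_c1 L (bc_zero X).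
Proof.
move=> d1.
have Pw z w i j : iter i g (val z) = iter j g (val w) ->
    (Cabs delta ^+ j) ^+ 2 * 1 = (Cabs delta ^+ i) ^+ 2 * 1 :> R.
  by rewrite d1 !expr1n.
pose h := weight_metric (fun=> 1).
have hE p (s : 'CV[R]_n -> Defs.total L) y : params (h := X) p ->
    frames (h := L) p s -> p.1 y -> h (s y) = 1.
  move=> Xp fs py; have [z yz] := param_punctured Xp py.
  move: py; rewrite {}yz => pz.
  by rewrite (frame_unit_vector fs pz) /h (weight_metric_unit_vector Pw).
exists h, (fun _ _ => 0), (closed_real_form11_0 X); split=> //.
- split=> [c t|p s Xp fs]; first exact: (weight_metricZ Pw).
  split=> [y py|]; first by rewrite (hE p s).
  apply/smooth_onP; apply: (@eq_smoothR _ _ _ (fun=> 1)) (hopf_open Xp) _ _.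
    by move=> y /set_mem py; rewrite (hE p s).
  exact/smoothR_cst/hopf_open/Xp.
- move=> p s Xp fs y py; rewrite (@eq_ddbar _ _ p.1 _ (fun=> 0)) //.
  + by rewrite ddbar0 scaler0.
  + exact: hopf_open.
  + by move=> w /set_mem pw; rewrite (hE p s)// ln1.
Qed.

End OneBundle.

(** The r-th power of a metric: with H = exp (ln H), the additive law of
[ln_metric_unit_vector] is multiplied by r, and r ln |delta1| = ln |delta2|
turns it into the multiplicative law required on L_delta2. *)
Lemma is_c1_scale (z0 : pt) delta1 delta2 (r : R) x :
  delta1 != 0 -> delta2 != 0 -> ln (Cabs delta2) = r * ln (Cabs delta1) ->
  is_c1 (flat_bundle g delta1) x -> is_c1 (flat_bundle g delta2) (bc_scale r x).
Proof.
move=> d1 d2 lnE [h [a [ha [[hZ hP] ah ->]]]].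
(* The value 0 where H is not positive keeps P equivariant at every point. *)
pose P z := if 0 < h (unit_vector delta1 z)
  then expR (r * ln (h (unit_vector delta1 z))) else 0.
have Pw z w i j : iter i g (val z) = iter j g (val w) ->
    (Cabs delta2 ^+ j) ^+ 2 * P z = (Cabs delta2 ^+ i) ^+ 2 * P w.
  move=> zw; rewrite /P; case: ifPn => z1; case: ifPn => w1.
  - have [_ E] := ln_metric_unit_vector d1 hZ zw w1.
    have d2X k : (Cabs delta2 ^+ k) ^+ 2 = expR (k%:R * (2 * ln (Cabs delta2))).
      rewrite mulrA -natrM expRM_natl lnK ?posrE ?Cabs_gt0//.
      by rewrite -exprM.
    rewrite !d2X -!expRD; congr expR; rewrite lnE.
    move/eqP: E; rewrite subr_eq => /eqP ->; ring.
  - by have [] := ln_metric_unit_vector d1 hZ (esym zw) z1; rewrite (negPf w1).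
  - by have [] := ln_metric_unit_vector d1 hZ zw w1; rewrite (negPf z1).
  - by rewrite !mulr0.
pose h2 := weight_metric (delta := delta2) P.
pose s1 y := unit_vector delta1 (insubd z0 y).
have hE p (s : 'CV[R]_n -> Defs.total (flat_bundle g delta2)) y :
    params (h := X) p -> frames (h := flat_bundle g delta2) p s -> p.1 y ->
    h2 (s y) = expR (r * ln (h (s1 y))).
  move=> Xp fs py; have [z yz] := param_punctured Xp py.
  move: py; rewrite {}yz => pz.
  rewrite (frame_unit_vector fs pz) /h2 (weight_metric_unit_vector d2 Pw).
  have [h0 _] := hP p s1 Xp (unit_frame delta1 z0 Xp).
  by move: (h0 _ pz); rewrite /P /s1 valKd => ->.
exists h2, (scale_form11 r a), (closed_real_form11Z r ha); split.
- split=> [c t|p s Xp fs]; first exact: (weight_metricZ d2 Pw).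
  split=> [y py|]; first by rewrite (hE p s) ?expR_gt0.
  have [h0 /smooth_onP sh] := hP p s1 Xp (unit_frame delta1 z0 Xp).
  have oX := hopf_open Xp.
  apply/smooth_onP; apply: eq_smoothR oX _
    (smoothR_expR oX (smoothRZ r oX (smoothR_ln oX h0 sh))).
  by move=> y /set_mem py; rewrite (hE p s).
- move=> p s Xp fs y py; have oX := hopf_open Xp.
  have E : {in p.1, (fun y => r * ln (h (s1 y))) =1 (fun y => ln (h2 (s y)))}.
    by move=> w /set_mem pw; rewrite (hE p s)// expRK.
  rewrite -(congr1 (fun M => _ *: M) (eq_ddbar oX E py)).
  rewrite (congr1 (fun M => _ *: M) (ddbarZ r (fun y => ln (h (s1 y))) y)).
  rewrite /scale_form11 (ah p s1 Xp (unit_frame delta1 z0 Xp) y py).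
  by rewrite !scalerA mulrC.
- exact/(bc_scale_class hopf_open).
Qed.

Lemma c1_flat_unit (z0 : pt) delta : delta != 0 -> Cabs delta = 1 ->
  c1 (flat_bundle g delta) = bc_zero X.
Proof.
move=> d0 d1; apply: (xget_unique _ (is_c1_zero d0 d1)) => y cy.
exact: (is_c1_unique d0 z0 cy (is_c1_zero d0 d1)).
Qed.

(** If L_delta1 has a Chern form, scale it and use uniqueness.  If it has none,
neither has L_delta2, by scaling with r^-1, and both classes are zero by
convention; r = 0 occurs only for |delta2| = 1, where both sides vanish. *)
Lemma c1_flat_scale (z0 : pt) delta1 delta2 (r : R) :
  delta1 != 0 -> delta2 != 0 -> Cabs delta1 != 1 ->
  ln (Cabs delta2) = r * ln (Cabs delta1) ->
  c1 (flat_bundle g delta2) = bc_scale r (c1 (flat_bundle g delta1)).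
Proof.
move=> d1 d2 nd1 lnE.
have [d21|nd2] := eqVneq (Cabs delta2) 1.
  move: lnE; rewrite d21 ln1 => /esym/eqP; rewrite mulf_eq0 ln_eq0 ?Cabs_gt0//.
  rewrite (negPf nd1) orbF => /eqP->.
  by rewrite (c1_flat_unit z0)// (bc_scale0 hopf_open).
have [[x cx]|ncx] := pselect (exists x, is_c1 (flat_bundle g delta1) x).
  have c1x : is_c1 _ (c1 (flat_bundle g delta1)) := xgetI _ cx.
  have c2x := is_c1_scale z0 d1 d2 lnE c1x.
  by apply: (xget_unique _ c2x) => y cy; exact: (is_c1_unique d2 z0 cy c2x).
rewrite [c1 (flat_bundle g delta1)]xgetPN => [|x cx]; last by apply: ncx; exists x.
rewrite (bc_scale_zero hopf_open); apply: xgetPN => x cx; apply: ncx.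
exists (bc_scale r^-1 x); apply: is_c1_scale cx => //.
rewrite lnE mulKf//; apply: contra_neq nd2 => r0.
by apply/eqP; rewrite -ln_eq0 ?Cabs_gt0// lnE r0 mul0r.
Qed.

End FlatBundles.

(** * Proportionality of the first Chern classes *)

Theorem proposition2p7 (R : realType) (n : nat) (hn : (2 <= n)%N)
    (gamma : 'CV[R]_n -> 'CV[R]_n) (hgamma : hopf_generator gamma) :
  (forall delta1 delta2 : CC R, delta1 != 0 -> delta2 != 0 ->
     bc_scale (ln (Cabs delta2)) (c1 (flat_bundle gamma delta1)) =
     bc_scale (ln (Cabs delta1)) (c1 (flat_bundle gamma delta2))) /\
  (forall delta1 delta2 : CC R, delta1 != 0 -> delta2 != 0 ->
     Cabs delta1 = Cabs delta2 ->
     c1 (flat_bundle gamma delta1) = c1 (flat_bundle gamma delta2)).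
Proof.
(* Some nonzero vector, which exists as n is positive. *)
have z0 : punctured R n.
  exists (const_mx 1); apply/eqP => /rowP/(_ (Ordinal (ltnW hn))).
  by rewrite !mxE => /eqP; rewrite oner_eq0.
have oX := @hopf_open R n gamma.
split=> delta1 delta2 d1 d2.
  have [u1|u1] := eqVneq (Cabs delta1) 1.
    by rewrite (c1_flat_unit gamma z0 d1 u1) u1 ln1 (bc_scale_zero oX) (bc_scale0 oX).
  have ln1_neq0 : ln (Cabs delta1) != 0 by rewrite ln_eq0 ?Cabs_gt0.
  rewrite (c1_flat_scale gamma z0 d1 d2 u1 (esym (divfK ln1_neq0 _))).
  by rewrite (bc_scale_scale oX) mulrC divfK.
move=> d12; have [u1|u1] := eqVneq (Cabs delta1) 1.
  have u2 : Cabs delta2 = 1 by rewrite -d12.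
  by rewrite (c1_flat_unit gamma z0 d1 u1) (c1_flat_unit gamma z0 d2 u2).
have lnE : ln (Cabs delta2) = 1 * ln (Cabs delta1) by rewrite mul1r d12.
apply/esym; exact: etrans (c1_flat_scale gamma z0 d1 d2 u1 lnE) (bc_scale1 oX _).
Qed.
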